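(* Let $D$ be a strongly connected balanced bipartite digraph of order $2a\geq 8$. Suppose that $d(x)+d(y)\geq 4a-3$ for every pair of distinct vertices $x,y$ with a common out-neighbour. If $D$ is not isomorphic to the digraph $D(8)$, then $D$ is hamiltonian.
   Context: Digraphs are finite, without loops and without multiple arcs (a pair of opposite arcs $x\to y$, $y\to x$, called a 2-cycle $x\leftrightarrow y$, is allowed). For a vertex $x$, $d(x)=d^+(x)+d^-(x)$ is the sum of its out-degree and in-degree. A bipartite digraph with partite sets $X,Y$ is balanced if $|X|=|Y|$. A digraph is hamiltonian if it has a directed cycle through all its vertices. $D(8)$ is the bipartite digraph with partite sets $X=\{x_0,x_1,x_2,x_3\}$, $Y=\{y_0,y_1,y_2,y_3\}$ whose arc set consists exactly of the arcs $y_0x_1$, $y_1x_0$, $x_2y_3$, $x_3y_2$ together with both arcs of each of the 2-cycles $x_i\leftrightarrow y_i$ ($i=0,1,2,3$), $y_0\leftrightarrow x_2$, $y_0\leftrightarrow x_3$, $y_1\leftrightarrow x_2$, $y_1\leftrightarrow x_3$. *)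

(* Defs.v *)
From mathcomp Require Import all_boot.

Set Implicit Arguments.
Unset Strict Implicit.
Unset Printing Implicit Defensive.

(* A digraph on the vertex type T is an irreflexive relation e : rel T;
   e x y means that x -> y is an arc. *)

Section Digraph.
Variables (T : finType) (e : rel T).

Definition outdeg (x : T) : nat := #|[set y | e x y]|.
Definition indeg (x : T) : nat := #|[set y | e y x]|.
Definition deg (x : T) : nat := outdeg x + indeg x.

Definition strongly_connected : Prop := forall x y : T, connect e x y.

Definition bipartite (X Y : {set T}) : Prop :=
  [/\ X :|: Y = [set: T], [disjoint X & Y] &
      forall x y : T, e x y ->
        (x \in X) && (y \in Y) || (x \in Y) && (y \in X)].

Definition balanced_bipartite : Prop :=
  exists X Y : {set T}, bipartite X Y /\ #|X| = #|Y|.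

(* ucycle accepts the empty sequence, which is not a directed cycle. *)
Definition hamiltonian : Prop :=
  exists c : seq T, [/\ ucycle e c, 1 < size c & forall x : T, x \in c].

Definition common_out_neighbour (x y : T) : Prop :=
  exists z : T, e x z /\ e y z.

End Digraph.

Definition isomorphic (T U : finType) (e : rel T) (e' : rel U) : Prop :=
  exists2 f : T -> U, bijective f & forall x y : T, e' (f x) (f y) = e x y.

(* In all three lists below (i, j) refers to the pair x_i, y_j. *)
Definition D8_two_cycles : seq (nat * nat) :=
  [:: (0, 0); (1, 1); (2, 2); (3, 3); (2, 0); (3, 0); (2, 1); (3, 1)].
Definition D8_single_xy : seq (nat * nat) := [:: (2, 3); (3, 2)].
Definition D8_single_yx : seq (nat * nat) := [:: (1, 0); (0, 1)].

(* inl i is x_i and inr j is y_j. *)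
Definition D8 : rel ('I_4 + 'I_4)%type := fun u v =>
  match u, v with
  | inl i, inr j => (val i, val j) \in D8_two_cycles ++ D8_single_xy
  | inr j, inl i => (val i, val j) \in D8_two_cycles ++ D8_single_yx
  | _, _ => false
  end.

(* Main.v *)
Require Import Defs.
From mathcomp Require Import all_boot.
From mathcomp Require Import zify.

(** Call a vertex rich if its degree is at least [2a - 1], that is, if at most
    one of the [2a] arcs it could carry is missing.  Two vertices that are not
    rich never have a common out-neighbour.  If one side has no rich vertex,
    every in-degree is [1] and strong connectivity makes the digraph a cycle.
    Otherwise each side has at most two vertices that are not rich, since a
    rich vertex has in-degree at least [a - 1] and is dominated by at most one
    of them; and if one side has two, the other has at most one.  Any cycle of
    length at least [4] through all vertices that are not rich extends to a
    hamiltonian one by splicing in rich pairs, so only a short cycle through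
    at most three exceptional vertices has to be found. *)

(** * Consequences of strong connectivity *)

Section Strong.
Variables (T : finType) (e : rel T).
Hypothesis strong : strongly_connected e.

(** A path from [u] to [w] starts in [S] and ends outside it, so one of its arcs leaves [S]. *)
Lemma strong_arc (S : pred T) (u w : T) : S u -> ~~ S w ->
  exists p q, [/\ S p, ~~ S q & e p q].
Proof.
move=> Su Sw; case/connectP: (strong u w) => p pth def_w; subst w.
elim: p u Su Sw pth => [|v p IH] u Su /=; first by rewrite Su.
move=> Sw /andP[euv pth].
case: (boolP (S v)) => [Sv|nSv]; first exact: IH Sv Sw pth.
by exists u, v; split.
Qed.

Lemma strong_out (u w : T) : w != u -> exists v, e u v.
Proof.
move=> nwu; case: (@strong_arc (pred1 u) u w) => [|//|p [q [/eqP-> _ euq]]].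
  exact: eqxx.
by exists q.
Qed.

Lemma strong_in (u w : T) : w != u -> exists v, e v u.
Proof.
move=> nwu; case: (@strong_arc (predC1 u) w u) => [//||p [q [_ Sq epq]]].
  by rewrite /= eqxx.
by move: Sq; rewrite negbK => /eqP <-; exists p.
Qed.

(** Every vertex has exactly one predecessor. Strong connectivity makes the predecessor map a single
    cyclic orbit, and this orbit read backwards follows the arcs. *)
Lemma indeg1_hamiltonian : 1 < #|T| ->
  (forall u v w : T, e u w -> e v w -> u = v) -> hamiltonian e.
Proof.
move=> T1 inj_e.
have T2 (u : T) : exists w, w != u.
  have/card_gt0P[w uw] : 0 < #|predC1 u| by rewrite cardC1; lia.
  by exists w.
(* The default [v] is never taken: strong connectivity gives every vertex an in-neighbour. *)
pose f v := odflt v [pick u | e u v].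
have ef v : e (f v) v.
  rewrite /f; case: pickP => [u //|noe] /=.
  have [w nwv] := T2 v.
  by have [u euv] := strong_in _ _ nwv; move: (noe u); rewrite euv.
(* A path from [x] to [y], walked backwards, is an iteration of [f]. *)
have fc x y : fconnect f y x.
  case/connectP: (strong x y) => p pth ->; elim: p x pth => [|z p IH] x /=.
    by rewrite connect0.
  case/andP=> exz /IH zp; apply: connect_trans zp _.
  by rewrite -(inj_e _ _ _ (ef z) exz) fconnect1.
have [x0 _] : exists x : T, x \in T by apply/card_gt0P; apply: ltnW.
have all_in z : z \in rev (orbit f x0) by rewrite mem_rev -fconnect_orbit.
exists (rev (orbit f x0)); split=> //.
  apply/andP; split; last by rewrite rev_uniq orbit_uniq.
  rewrite rev_cycle; have := proj1 (orbitPcycle 2 0) (fc x0 (f x0)).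
  by apply: sub_cycle => u v /eqP <-.
apply: leq_trans T1 _; rewrite cardT.
by apply: uniq_leq_size => [|z _]; first exact: enum_uniq.
Qed.

End Strong.

(** * Counting missing arcs between the two sides *)

Section Bipartite.
Variables (T : finType) (e : rel T) (a : nat) (s : T -> bool).
Hypothesis side : forall u v, e u v -> s v = ~~ s u.
Hypothesis side_card : forall b, #|[set v | s v == b]| = a.

(** By [side], all out-neighbours of [v] are among the [a] vertices of the opposite side; the second
    set counts the missing arcs. *)
Lemma outdegC (v : T) :
  outdeg e v + #|[set u | (s u == ~~ s v) && ~~ e v u]| = a.
Proof.
rewrite -[RHS](side_card (~~ s v)) -[RHS](cardsID [set u | e v u]); congr (_ + _).
  apply: eq_card => u; rewrite !inE; case: (boolP (e v u)) => [/side ->|].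
    by rewrite eqxx.
  by rewrite andbF.
by apply: eq_card => u; rewrite !inE andbC.
Qed.

Lemma indegC (v : T) :
  indeg e v + #|[set u | (s u == ~~ s v) && ~~ e u v]| = a.
Proof.
rewrite -[RHS](side_card (~~ s v)) -[RHS](cardsID [set u | e u v]); congr (_ + _).
  apply: eq_card => u; rewrite !inE; case: (boolP (e u v)) => [/side ->|].
    by rewrite negbK eqxx.
  by rewrite andbF.
by apply: eq_card => u; rewrite !inE andbC.
Qed.

Lemma outdeg_miss1 (v u w : T) : s u = ~~ s v -> s w = ~~ s v -> u != w ->
  a <= (outdeg e v).+1 -> ~~ e v u -> e v w.
Proof.
move=> su sw nuw dv nu; apply: contraT => nw.
suff : 1 < #|[set u | (s u == ~~ s v) && ~~ e v u]| by have := outdegC v; lia.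
by apply/card_gt1P; exists u, w; rewrite !inE su sw eqxx nu nw.
Qed.

Lemma indeg_miss1 (v u w : T) : s u = ~~ s v -> s w = ~~ s v -> u != w ->
  a <= (indeg e v).+1 -> ~~ e u v -> e w v.
Proof.
move=> su sw nuw dv nu; apply: contraT => nw.
suff : 1 < #|[set u | (s u == ~~ s v) && ~~ e u v]| by have := indegC v; lia.
by apply/card_gt1P; exists u, w; rewrite !inE su sw eqxx nu nw.
Qed.

Lemma outdeg_lt (v u : T) : s u = ~~ s v -> ~~ e v u -> outdeg e v < a.
Proof.
move=> su nu.
suff : 0 < #|[set u | (s u == ~~ s v) && ~~ e v u]| by have := outdegC v; lia.
by apply/card_gt0P; exists u; rewrite inE su eqxx.
Qed.

Lemma indeg_lt (v u : T) : s u = ~~ s v -> ~~ e u v -> indeg e v < a.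
Proof.
move=> su nu.
suff : 0 < #|[set u | (s u == ~~ s v) && ~~ e u v]| by have := indegC v; lia.
by apply/card_gt0P; exists u; rewrite inE su eqxx.
Qed.

Definition rich (v : T) : bool := 2 * a <= (deg e v).+1.

(** A vertex [u] with no arc to or from [v] would cost [v] two of its [2 * a] possible arcs. *)
Lemma rich_adj (v u : T) : rich v -> s u = ~~ s v -> e v u || e u v.
Proof.
rewrite /rich /deg => rv su; apply: contraT; rewrite negb_or => /andP[no ni].
by have := outdeg_lt _ _ su no; have := indeg_lt _ _ su ni; lia.
Qed.

(** An arc missing between [v] and [u] is the only one that a rich [v] can lack. *)
Lemma rich_miss1 (v u w : T) : rich v -> s u = ~~ s v -> s w = ~~ s v ->
  u != w -> ~~ (e v u && e u v) -> e v w && e w v.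
Proof.
rewrite /rich /deg => rv su sw nuw; rewrite negb_and.
have := outdegC v; have := indegC v => hi ho.
case/orP => [no|ni].
  have lo := outdeg_lt _ _ su no.
  rewrite (outdeg_miss1 _ _ _ su sw nuw _ no) /=; last by lia.
  by apply: contraT => /(indeg_lt _ _ sw); lia.
have li := indeg_lt _ _ su ni.
rewrite (indeg_miss1 _ _ _ su sw nuw _ ni) ?andbT; last by lia.
by apply: contraT => /(outdeg_lt _ _ sw); lia.
Qed.

(** * Extending cycles by rich vertices *)

Lemma fresh (b : bool) (l : seq T) : size l < a ->
  exists2 v, s v = b & v \notin l.
Proof.
move=> la; case: (pickP [pred v | (s v == b) && (v \notin l)]) => [v|none].
  by case/andP=> /eqP; exists v.
suff : a <= size l by lia.
rewrite -(side_card b) cardE; apply: uniq_leq_size; first exact: enum_uniq.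
move=> v; rewrite mem_enum inE => sv; move: (none v).
by rewrite /= sv /= => /negbFE.
Qed.

Lemma count_side_le (c : seq T) (b : bool) : uniq c ->
  count (fun v => s v == b) c <= a.
Proof.
move=> uc; rewrite -size_filter -(side_card b) cardE; apply: uniq_leq_size.
  exact: filter_uniq.
by move=> v; rewrite mem_filter mem_enum inE => /andP[].
Qed.

(* The pair [p], [q] has at most two missing arcs, and each of them blocks only
   one of the three places at which the pair could be spliced in. *)
Lemma rich_insert (u0 u1 u2 u3 p q : T) (r : seq T) :
  cycle e [:: u0, u1, u2, u3 & r] -> u0 != u2 -> u1 != u3 ->
  s p = ~~ s u0 -> s q = s u0 -> rich p -> rich q ->
  q != u0 -> q != u2 -> p != u1 ->
  exists2 c, cycle e c & perm_eq c [:: p, q, u0, u1, u2, u3 & r].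
Proof.
move=> /= /and4P[e01 e12 e23 cyc] n02 n13 sp sq rp rq nq0 nq2 np1.
have s1 := side _ _ e01; have s2 := side _ _ e12; have s3 := side _ _ e23.
have sqp : s q = ~~ s p by rewrite sp negbK.
have s0p : s u0 = ~~ s p by rewrite sp negbK.
have s2p : s u2 = ~~ s p by rewrite s2 s1 sp.
have s1q : s u1 = ~~ s q by rewrite s1 sq.
have s3q : s u3 = ~~ s q by rewrite s3 s2 s1 sq negbK.
have spq : s p = ~~ s q by rewrite sp sq.
have P1 : e u0 p -> e p q -> e q u1 ->
    exists2 c, cycle e c & perm_eq c [:: p, q, u0, u1, u2, u3 & r].
  move=> h1 h2 h3; exists [:: u0, p, q, u1, u2, u3 & r].
    by rewrite /= h1 h2 h3 e12 e23.
  by rewrite (perm_catCA [:: u0] [:: p; q]).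
have P2 : e u1 q -> e q p -> e p u2 ->
    exists2 c, cycle e c & perm_eq c [:: p, q, u0, u1, u2, u3 & r].
  move=> h1 h2 h3; exists [:: u0, u1, q, p, u2, u3 & r].
    by rewrite /= e01 h1 h2 h3 e23.
  rewrite (perm_catCA [:: u0; u1] [:: q; p]).
  by rewrite (perm_catCA [:: q] [:: p]).
have P3 : e u2 p -> e p q -> e q u3 ->
    exists2 c, cycle e c & perm_eq c [:: p, q, u0, u1, u2, u3 & r].
  move=> h1 h2 h3; exists [:: u0, u1, u2, p, q, u3 & r].
    by rewrite /= e01 e12 h1 h2 h3.
  by rewrite (perm_catCA [:: u0; u1; u2] [:: p; q]).
(* An arc missing between [p] and [q] is the only one missing at either, so every other arc needed
   is present. *)
case: (boolP (e p q && e q p)) => [/andP[epq eqp]|npq]; last first.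
  have nqp : ~~ (e q p && e p q) by rewrite andbC.
  case: (boolP (e p q)) => [epq|].
    apply: P1 => //.
      by case/andP: (rich_miss1 _ _ _ rp sqp s0p nq0 npq).
    by case/andP: (rich_miss1 _ _ _ rq spq s1q np1 nqp).
  move=> nepq; apply: P2.
  - by case/andP: (rich_miss1 _ _ _ rq spq s1q np1 nqp).
  - by have := rich_adj _ _ rp sqp; rewrite (negbTE nepq).
  by case/andP: (rich_miss1 _ _ _ rp sqp s2p nq2 npq).
(* Now only arcs to the cycle can be missing, at most one at [p] and one at [q]; which ones are
   missing decides the place. *)
case: (boolP (e u0 p)) => [e0p|n0p].
  case: (boolP (e q u1)) => [eq1|nq1]; first exact: P1.
  have /andP[eq3 _] : e q u3 && e u3 q.
    by apply: rich_miss1 rq s1q s3q n13 _; rewrite (negbTE nq1).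
  case: (boolP (e u2 p)) => [e2p|n2p]; first exact: P3.
  apply: P2 => //.
    by have := rich_adj _ _ rq s1q; rewrite (negbTE nq1).
  by have := rich_adj _ _ rp s2p; rewrite (negbTE n2p) orbF.
have /andP[ep2 e2p] : e p u2 && e u2 p.
  by apply: rich_miss1 rp s0p s2p n02 _; rewrite (negbTE n0p) andbF.
case: (boolP (e u1 q)) => [e1q|n1q]; first exact: P2.
apply: P3 => //.
suff /andP[] : e q u3 && e u3 q by [].
by apply: rich_miss1 rq s1q s3q n13 _; rewrite (negbTE n1q) andbF.
Qed.

Lemma count_side_gap (b : bool) (v : T) (c : seq T) : uniq c -> v \notin c ->
  s v = b -> count (fun w => s w == b) c < a.
Proof.
move=> uc vc sv; have uvc : uniq (v :: c) by rewrite /= vc.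
by have := count_side_le (v :: c) b uvc; rewrite /= sv eqxx.
Qed.

Lemma fresh_side (b : bool) (c : seq T) :
  count (fun w => s w == b) c < a -> exists2 v, s v = b & v \notin c.
Proof.
rewrite -size_filter => /(fresh b) [v sv]; rewrite mem_filter sv eqxx /=.
by exists v.
Qed.

(** Induction on the number of vertices off the cycle. By balance, one uncovered vertex forces an
    uncovered vertex on each side; both are rich, and splicing them in preserves the balance. *)
Lemma cycle_extend (c : seq T) : ucycle e c -> 3 < size c ->
  count (fun v => s v == true) c = count (fun v => s v == false) c ->
  (forall v, v \notin c -> rich v) -> hamiltonian e.
Proof.
have [n] := ubnP (#|T| - size c).
elim: n c => // n IH c; rewrite ltnS => le_n /andP[cyc uc] c4 bal richc.
case: (pickP [pred v | v \notin c]) => [v /= vc|allc]; last first.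
  exists c; split; [by apply/andP | by lia |].
  by move=> v; have := allc v => /= /negbFE.
have gap b : count (fun w => s w == b) c < a.
  have := count_side_gap (s v) v c uc vc erefl; case: (s v) b => [] [] //.
    by rewrite bal.
  by rewrite bal.
have cT : size c < #|T|.
  apply: leq_trans (_ : size (v :: c) <= _) => //; rewrite cardT.
  by apply: uniq_leq_size; rewrite /= ?vc // => w; rewrite mem_enum.
case: c c4 le_n cyc uc bal richc vc gap cT => [|u0 [|u1 [|u2 [|u3 r]]]] //.
move=> c4 le_n cyc uc bal richc vc gap cT.
have [p sp pc] := fresh_side (~~ s u0) _ (gap _).
have [q sq qc] := fresh_side (s u0) _ (gap _).
have npq : p != q by apply/eqP => E; move: sp; rewrite E sq; case: (s u0).
have n02 : u0 != u2.
  by move: uc; rewrite /= !inE !negb_or => /andP[/and4P[]].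
have n13 : u1 != u3.
  by move: uc; rewrite /= !inE !negb_or => /and3P[_ /and3P[]].
have nq0 : q != u0 by move: qc; rewrite !inE !negb_or => /and3P[].
have nq2 : q != u2 by move: qc; rewrite !inE !negb_or => /and4P[].
have np1 : p != u1 by move: pc; rewrite !inE !negb_or => /and3P[].
have [c' cyc' pc'] := rich_insert _ _ _ _ _ _ _ cyc n02 n13 sp sq
   (richc _ pc) (richc _ qc) nq0 nq2 np1.
apply: (IH c').
- rewrite (perm_size pc') /=; move: le_n cT => /=; clear; lia.
- apply/andP; split=> //; rewrite (perm_uniq pc').
  by rewrite cons_uniq cons_uniq in_cons negb_or npq pc qc.
- by rewrite (perm_size pc').
- rewrite !(permP pc').
  move: bal; move: [:: u0, u1, u2, u3 & r] => c0 /= ->.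
  by rewrite sp sq; case: (s u0).
move=> w; rewrite (perm_mem pc') !in_cons !negb_or => /and3P[_ _ wc].
by apply: richc; rewrite !in_cons !negb_or.
Qed.

Lemma uniq_sides (c : seq T) : uniq (filter s c) -> uniq (filter (predC s) c) ->
  uniq c.
Proof.
move=> u1 u2; rewrite -(perm_uniq (permEl (perm_filterC s c))) cat_uniq u1 u2.
rewrite andbT; apply/hasPn => v; rewrite !mem_filter => /andP[/= /negbTE->].
by [].
Qed.

(** Vertices of opposite sides are distinct anyway, so repetitions only have to be excluded within
    each side. *)
Lemma sides_extend (c : seq T) : cycle e c -> 3 < size c ->
  uniq (filter s c) -> uniq (filter (predC s) c) ->
  size (filter s c) = size (filter (predC s) c) ->
  (forall v, v \notin c -> rich v) -> hamiltonian e.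
Proof.
move=> cyc c4 us uns sz; apply: cycle_extend => //.
  by apply/andP; split=> //; apply: uniq_sides.
move: sz; rewrite !size_filter => sz.
rewrite (@eq_count _ _ s) ?sz; last by move=> v; rewrite eqb_id.
by apply: eq_count => v /=; case: (s v).
Qed.

Lemma cycle4_extend (u0 u1 u2 u3 : T) :
  e u0 u1 -> e u1 u2 -> e u2 u3 -> e u3 u0 -> u0 != u2 -> u1 != u3 ->
  (forall v, v \notin [:: u0; u1; u2; u3] -> rich v) -> hamiltonian e.
Proof.
move=> e0 e1 e2 e3 n02 n13 nr.
have s1 := side _ _ e0; have s2 := side _ _ e1; have s3 := side _ _ e2.
apply: (sides_extend [:: u0; u1; u2; u3]) => //; first by rewrite /= e0 e1 e2 e3.
(* With all sides expressed through [s u0], the filters compute to the even and the odd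
   positions. *)
all: rewrite /= s3 s2 s1 !negbK; case: (s u0) => //=.
all: by rewrite !inE ?n02 ?n13.
Qed.

Lemma cycle6_extend (u0 u1 u2 u3 u4 u5 : T) :
  e u0 u1 -> e u1 u2 -> e u2 u3 -> e u3 u4 -> e u4 u5 -> e u5 u0 ->
  uniq [:: u0; u2; u4] -> uniq [:: u1; u3; u5] ->
  (forall v, v \notin [:: u0; u1; u2; u3; u4; u5] -> rich v) -> hamiltonian e.
Proof.
move=> e0 e1 e2 e3 e4 e5 q0 q1 nr.
have s1 := side _ _ e0; have s2 := side _ _ e1; have s3 := side _ _ e2.
have s4 := side _ _ e3; have s5 := side _ _ e4.
apply: (sides_extend [:: u0; u1; u2; u3; u4; u5]) => //.
  by rewrite /= e0 e1 e2 e3 e4 e5.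
all: by rewrite /= s5 s4 s3 s2 s1 !negbK; case: (s u0).
Qed.

Lemma cycle8_extend (u0 u1 u2 u3 u4 u5 u6 u7 : T) :
  e u0 u1 -> e u1 u2 -> e u2 u3 -> e u3 u4 -> e u4 u5 -> e u5 u6 ->
  e u6 u7 -> e u7 u0 ->
  uniq [:: u0; u2; u4; u6] -> uniq [:: u1; u3; u5; u7] ->
  (forall v, v \notin [:: u0; u1; u2; u3; u4; u5; u6; u7] -> rich v) ->
  hamiltonian e.
Proof.
move=> e0 e1 e2 e3 e4 e5 e6 e7 q0 q1 nr.
have s1 := side _ _ e0; have s2 := side _ _ e1; have s3 := side _ _ e2.
have s4 := side _ _ e3; have s5 := side _ _ e4; have s6 := side _ _ e5.
have s7 := side _ _ e6.
apply: (sides_extend [:: u0; u1; u2; u3; u4; u5; u6; u7]) => //.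
  by rewrite /= e0 e1 e2 e3 e4 e5 e6 e7.
all: by rewrite /= s7 s6 s5 s4 s3 s2 s1 !negbK; case: (s u0).
Qed.

(** * At most one exception on each side *)

Hypothesis strong : strongly_connected e.
Hypothesis a_gt3 : 3 < a.

Lemma fresh3 (b : bool) (l : seq T) : size l <= 3 ->
  exists2 v, s v = b & v \notin l.
Proof. by move=> l3; apply: fresh; apply: leq_ltn_trans a_gt3. Qed.

Lemma side_neq (u v : T) : s u = ~~ s v -> u != v.
Proof. by move=> suv; apply/eqP => E; move: suv; rewrite E; case: (s v). Qed.

Lemma out_neighbour (u : T) : exists v, e u v.
Proof.
have [w _] := fresh3 true [:: u] isT; rewrite inE => nwu.
exact: (strong_out _ _ strong u w).
Qed.

Lemma in_neighbour (u : T) : exists v, e v u.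
Proof.
have [w _] := fresh3 true [:: u] isT; rewrite inE => nwu.
exact: (strong_in _ _ strong u w).
Qed.

(** Strong connectivity yields an arc from [y1] to some [x'] other than [x1]. Any further [y] on the
    side of [y1] lacks the arc from [x1], hence no other, and closes the 4-cycle [x1], [y1], [x'],
    [y]. *)
Lemma only_out_hamiltonian (x1 y1 : T) : s y1 = ~~ s x1 ->
  (forall v, v != x1 -> v != y1 -> rich v) ->
  (forall y, e x1 y -> y = y1) -> hamiltonian e.
Proof.
move=> sy1 nr only.
have exy : e x1 y1 by have [y exy] := out_neighbour x1; rewrite -(only y).
have [w _] := fresh3 true [:: x1; y1] isT; rewrite !inE => nw.
have [] := strong_arc _ _ strong (pred2 x1 y1) x1 w; rewrite /= ?eqxx // => p [x'].
rewrite negb_or => -[/orP[]/eqP-> /andP[nx nx'] epx].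
  by case/eqP: nx'; apply: only.
have [y sy] := fresh3 (s y1) [:: y1] isT; rewrite inE => ny1.
have sx1 : s x1 = ~~ s y by rewrite sy sy1 negbK.
have ry : rich y by apply: nr => //; apply: side_neq; rewrite sx1 negbK.
have nxy : ~~ e x1 y by apply/negP => /only E; rewrite E eqxx in ny1.
have eyx : e y x1 by have := rich_adj _ _ ry sx1; rewrite (negbTE nxy) orbF.
have /andP[_ exy'] : e y x' && e x' y.
  apply: (rich_miss1 y x1) => //; last by rewrite (negbTE nxy) andbF.
    by rewrite sy; apply: side.
  by rewrite eq_sym.
apply: (cycle4_extend x1 y1 x' y) => //; rewrite ?[x1 == _]eq_sym ?[y1 == _]eq_sym //.
by move=> v; rewrite !inE !negb_or => /and4P[? ? _ _]; apply: nr.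
Qed.

(** The arc-reversed counterpart of [only_out_hamiltonian]: an arc enters the pair at [y1], and the
    cycle is [x], [y1], [x1], [y]. *)
Lemma only_in_hamiltonian (x1 y1 : T) : s y1 = ~~ s x1 ->
  (forall v, v != x1 -> v != y1 -> rich v) ->
  (forall y, e y x1 -> y = y1) -> hamiltonian e.
Proof.
move=> sy1 nr only.
have eyx : e y1 x1 by have [y eyx] := in_neighbour x1; rewrite -(only y).
have [w _] := fresh3 true [:: x1; y1] isT; rewrite !inE => nw.
have [] := strong_arc _ _ strong (predC (pred2 x1 y1)) w x1.
- by [].
- by rewrite /= eqxx.
move=> x [q]; rewrite /= negb_or negbK => -[/andP[nx nx'] /orP[]/eqP-> exq].
  by case/eqP: nx'; apply: only.
have [y sy] := fresh3 (s y1) [:: y1] isT; rewrite inE => ny1.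
have sx1 : s x1 = ~~ s y by rewrite sy sy1 negbK.
have ry : rich y by apply: nr => //; apply: side_neq; rewrite sx1 negbK.
have nyx : ~~ e y x1 by apply/negP => /only E; rewrite E eqxx in ny1.
have exy : e x1 y by have := rich_adj _ _ ry sx1; rewrite (negbTE nyx).
have /andP[eyx' _] : e y x && e x y.
  apply: (rich_miss1 y x1) => //; last by rewrite (negbTE nyx).
    by rewrite sy (side _ _ exq) negbK.
  by rewrite eq_sym.
apply: (cycle4_extend x y1 x1 y) => //; rewrite ?[y1 == _]eq_sym //.
by move=> v; rewrite !inE !negb_or => /and4P[_ ? ? _]; apply: nr.
Qed.

(** If the two given neighbours coincide, a third vertex [z] of their side is rich, hence adjacent
    to [x1] in some direction, and replaces one of them. *)
Lemma distinct_neighbours (x1 y1 : T) : s y1 = ~~ s x1 ->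
  (forall v, v != x1 -> v != y1 -> rich v) ->
  (exists2 y, e x1 y & y != y1) -> (exists2 y, e y x1 & y != y1) ->
  exists y y', [/\ e y x1, e x1 y', y != y1, y' != y1 & y != y'].
Proof.
move=> sy1 nr [y' exy' ny'] [y eyx ny].
case: (eqVneq y y') => [E|nyy']; last by exists y, y'.
have [z sz] := fresh3 (s y1) [:: y; y1] isT; rewrite !inE negb_or => /andP[nzy nz1].
have sx1 : s x1 = ~~ s z by rewrite sz sy1 negbK.
have rz : rich z by apply: nr => //; apply: side_neq; rewrite sx1 negbK.
case/orP: (rich_adj _ _ rz sx1) => [ezx|exz].
  by exists z, y'; split; rewrite // -E.
by exists y, z; split; rewrite // eq_sym.
Qed.

(** Two paths of length two, through [x1] and through [y1], are joined by two linking arcs into a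
    6-cycle containing both exceptions. *)
Lemma two_detours_hamiltonian (x1 y1 y y' x x' : T) :
  (forall v, v != x1 -> v != y1 -> rich v) ->
  e y x1 -> e x1 y' -> e x y1 -> e y1 x' -> e y' x -> e x' y ->
  y != y1 -> y' != y1 -> y != y' -> x != x1 -> x' != x1 -> x != x' ->
  hamiltonian e.
Proof.
move=> nr h1 h2 h3 h4 h5 h6 ny ny' nyy' nx nx' nxx'.
apply: (cycle6_extend y x1 y' x y1 x') => //.
- by rewrite /= !inE negb_or ny ny' nyy'.
- by rewrite /= !inE negb_or ![x1 == _]eq_sym nx nx' nxx'.
by move=> v; rewrite !inE !negb_or => /and5P[_ ? _ _ /andP[? _]]; apply: nr.
Qed.

(** The missing link from [y'] to [x] is the only arc missing at either end, so [y'] leads to a new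
    [x2] and a new [y2] leads to [x]. Either [x2] replaces [x], or the link is lengthened to [y'],
    [x2], [y2], [x]. *)
Lemma blocked_detour_hamiltonian (x1 y1 y y' x x' : T) : s y1 = ~~ s x1 ->
  (forall v, v != x1 -> v != y1 -> rich v) ->
  e y x1 -> e x1 y' -> e x y1 -> e y1 x' -> ~~ e y' x -> e x' y ->
  y != y1 -> y' != y1 -> y != y' -> x != x1 -> x' != x1 -> x != x' ->
  hamiltonian e.
Proof.
move=> sy1 nr eyx exy' exy eyx' ny'x ex'y ny ny' nyy' nx nx' nxx'.
have sy' : s y' = s y1 by rewrite (side _ _ exy').
have sx : s x = s x1.
  by apply: negb_inj; rewrite -(side _ _ exy).
have ry v : s v = s y1 -> v != y1 -> rich v.
  by move=> sv nv; apply: nr => //; apply: side_neq; rewrite sv.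
have rx v : s v = s x1 -> v != x1 -> rich v.
  by move=> sv nv; apply: nr => //; apply: side_neq; rewrite sv sy1 negbK.
have opp u v : s u = s x1 -> s v = s y1 -> s u = ~~ s v.
  by move=> -> ->; rewrite sy1 negbK.
have opp' u v : s u = s x1 -> s v = s y1 -> s v = ~~ s u by move=> -> ->.
(* Three vertices per side are in use so far, and each side has at least four. *)
have [x2 sx2] := fresh3 (s x1) [:: x1; x; x'] isT.
rewrite !inE !negb_or => /and3P[nx21 nx2 nx2'].
have [y2 sy2] := fresh3 (s y1) [:: y1; y; y'] isT.
rewrite !inE !negb_or => /and3P[ny21 ny2 ny2'].
have /andP[ey'x2 _] : e y' x2 && e x2 y'.
  apply: (rich_miss1 y' x); rewrite ?(negbTE ny'x) ?[x == _]eq_sym //.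
  - exact: ry.
  - exact: opp.
  exact: opp.
have /andP[_ ey2x] : e x y2 && e y2 x.
  apply: (rich_miss1 x y'); rewrite ?(negbTE ny'x) ?andbF ?[y' == _]eq_sym //.
  - exact: rx.
  - exact: opp'.
  exact: opp'.
case: (boolP (e x2 y1)) => [ex2|nex2].
  by apply: (two_detours_hamiltonian x1 y1 y y' x2 x').
have /andP[ex2y2 _] : e x2 y2 && e y2 x2.
  apply: (rich_miss1 x2 y1); rewrite ?(negbTE nex2) ?[y1 == _]eq_sym //.
  - exact: rx.
  - exact: opp'.
  exact: opp'.
apply: (cycle8_extend y x1 y' x2 y2 x y1 x') => //.
- by rewrite /= !inE !negb_or nyy' ny [y == _]eq_sym ny2 [y' == _]eq_sym ny2' ny' ny21.
- by rewrite /= !inE !negb_or ![x1 == _]eq_sym nx nx' nx21 nx2 nx2' nxx'.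
by move=> v; rewrite !inE !negb_or => /and5P[_ ? _ _ /and4P[_ _ ? _]]; apply: nr.
Qed.

(** Unless one of [x1], [y1] has only the other as out-neighbour or as in-neighbour, each lies on a
    detour avoiding the other; the proof then turns on the two arcs linking these detours. *)
Lemma one_exception_hamiltonian (x1 y1 : T) : s y1 = ~~ s x1 ->
  (forall v, v != x1 -> v != y1 -> rich v) -> hamiltonian e.
Proof.
move=> sy1 nr.
have sx1 : s x1 = ~~ s y1 by rewrite sy1 negbK.
have nr' v : v != y1 -> v != x1 -> rich v by move=> ? ?; apply: nr.
have outP x y : s y = ~~ s x -> (forall v, v != x -> v != y -> rich v) ->
    hamiltonian e \/ exists2 z, e x z & z != y.
  move=> sy r; case: (pickP [pred z | e x z && (z != y)]) => [z /andP[]|none].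
    by right; exists z.
  left; apply: (only_out_hamiltonian x y) => // z exz.
  by have := none z; rewrite /= exz => /negbFE/eqP.
have inP x y : s y = ~~ s x -> (forall v, v != x -> v != y -> rich v) ->
    hamiltonian e \/ exists2 z, e z x & z != y.
  move=> sy r; case: (pickP [pred z | e z x && (z != y)]) => [z /andP[]|none].
    by right; exists z.
  left; apply: (only_in_hamiltonian x y) => // z ezx.
  by have := none z; rewrite /= ezx => /negbFE/eqP.
case: (outP _ _ sy1 nr) => // ox; case: (inP _ _ sy1 nr) => // ix.
case: (outP _ _ sx1 nr') => // oy; case: (inP _ _ sx1 nr') => // iy.
have [y [y' [eyx exy' ny ny' nyy']]] := distinct_neighbours _ _ sy1 nr ox ix.
have [x [x' [exy eyx' nx nx' nxx']]] := distinct_neighbours _ _ sx1 nr' oy iy.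
case: (boolP (e y' x)) => [ey'x|ny'x]; case: (boolP (e x' y)) => [ex'y|nx'y].
- exact: (two_detours_hamiltonian x1 y1 y y' x x').
- exact: (blocked_detour_hamiltonian y1 x1 x x' y y').
- exact: (blocked_detour_hamiltonian x1 y1 y y' x x').
(* Both links are missing. They are the only arcs missing at [x] and [x'], so these two vertices can
   swap roles in the 6-cycle. *)
have sy : s y = s y1 by apply: negb_inj; rewrite -(side _ _ eyx).
have sy' : s y' = s y1 by rewrite (side _ _ exy').
have sx : s x = s x1 by apply: negb_inj; rewrite -(side _ _ exy).
have sx' : s x' = s x1 by rewrite (side _ _ eyx').
have rx v : s v = s x1 -> v != x1 -> rich v.
  by move=> sv nv; apply: nr => //; apply: side_neq; rewrite sv.
have opp u v : s u = s x1 -> s v = s y1 -> s v = ~~ s u by move=> -> ->.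
have fullx v : s v = s y1 -> y' != v -> e x v && e v x.
  move=> sv nv; apply: (rich_miss1 x y'); rewrite ?(negbTE ny'x) ?andbF //.
  - exact: rx.
  - exact: opp.
  exact: opp.
have fullx' v : s v = s y1 -> y != v -> e x' v && e v x'.
  move=> sv nv; apply: (rich_miss1 x' y); rewrite ?(negbTE nx'y) //.
  - exact: rx.
  - exact: opp.
  exact: opp.
have /andP[_ eyx0] := fullx y1 erefl ny'.
have /andP[ex'y1 _] := fullx' y1 erefl ny.
have /andP[exy0 _] : e x y && e y x by apply: fullx; rewrite // eq_sym.
have /andP[_ ey'x'] := fullx' y' sy' nyy'.
by apply: (two_detours_hamiltonian x1 y1 y y' x' x); rewrite // eq_sym.
Qed.

(** * The degree condition and several exceptions on one side *)

Hypothesis degree_sum : forall x y : T, x != y -> common_out_neighbour e x y ->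
  deg e x + deg e y >= 4 * a - 3.

(** Call a vertex poor if it is not rich. Two poor vertices have degree sum at most [4 * a - 4]. *)
Lemma poor_disjoint (u v w : T) : ~~ rich u -> ~~ rich v -> u != v ->
  e u w -> ~~ e v w.
Proof.
rewrite /rich -!ltnNge => ru rv nuv euw; apply/negP => evw.
by have := degree_sum u v nuv (ex_intro _ w (conj euw evw)); lia.
Qed.

(** Vertices opposite to side [b] have at most one in-neighbour by [poor_disjoint], too few for a
    rich vertex. So both sides are entirely poor and the same bound holds everywhere. *)
Lemma no_rich_side_hamiltonian (b : bool) :
  (forall v, s v = b -> ~~ rich v) -> hamiltonian e.
Proof.
move=> poor_b.
have uniq_in c w : (forall v, s v = c -> ~~ rich v) -> s w = ~~ c ->
    forall u v, e u w -> e v w -> u = v.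
  move=> poor_c sw u v euw evw; apply/eqP; apply: contraTT (evw) => nuv.
  have sc z : e z w -> s z = c.
    by move=> ezw; apply: negb_inj; rewrite -sw (side _ _ ezw).
  exact: poor_disjoint (poor_c u (sc u euw)) (poor_c v (sc v evw)) nuv euw.
have poor_nb y : s y = ~~ b -> ~~ rich y.
  move=> sy; apply/negP => ry.
  have [u1 su1 _] := fresh3 b [::] isT.
  have [u2 su2] := fresh3 b [:: u1] isT; rewrite !inE => n21.
  have [u3 su3] := fresh3 b [:: u1; u2] isT.
  rewrite !inE negb_or => /andP[n31 n32].
  (* Of any two vertices on side [b] at least one dominates a rich [y]; three vertices thus
     contradict the single in-neighbour. *)
  have in1 u v : s u = b -> s v = b -> u != v -> e u y || e v y.
    move=> su sv nuv; case: (boolP (e u y)) => //= nu.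
    suff /andP[] : e y v && e v y by [].
    by apply: (rich_miss1 y u); rewrite ?(negbTE nu) ?andbF // ?su ?sv sy negbK.
  have inj u v : u != v -> e u y -> ~~ e v y.
    by move=> nuv eu; apply: contra nuv => ev; rewrite (uniq_in _ _ poor_b sy _ _ eu ev).
  have := in1 _ _ su2 su1 n21; have := in1 _ _ su3 su1 n31.
  have := in1 _ _ su3 su2 n32.
  case: (boolP (e u3 y)) => [h3|h3] /=.
    by rewrite (negbTE (inj _ _ n31 h3)) (negbTE (inj _ _ n32 h3)).
  by move=> h2; rewrite (negbTE (inj _ _ n21 h2)).
apply: indeg1_hamiltonian => //.
  have [u1 _ _] := fresh3 b [::] isT; have [u2 _] := fresh3 b [:: u1] isT.
  by rewrite inE => n21; apply/card_gt1P; exists u2, u1.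
move=> u v w; case: (eqVneq (s w) b) => sw.
  by apply: (uniq_in _ _ poor_nb); rewrite sw negbK.
by apply: (uniq_in _ _ poor_b); case: (s w) b {poor_b uniq_in poor_nb} sw => [] [].
Qed.

(** The case where [x1] leads to the one possible exception [y1] opposite. Either [y1] leads
    straight to [x2], or this is the only arc missing out of [y1] and a rich pair [x], [z] bridges
    the gap. *)
Lemma two_poor_y1_hamiltonian (x1 x2 y1 z2 : T) :
  s x2 = s x1 -> s y1 = ~~ s x1 -> x1 != x2 ->
  (forall v, v != x1 -> v != x2 -> v != y1 -> rich v) ->
  (forall y x, s y = s y1 -> y != y1 -> s x = s x1 -> e y x) ->
  (forall y x, s y = s y1 -> y != y1 -> s x = s x1 -> x != x1 -> x != x2 ->
     e x y) ->
  (forall u w, s u = s x1 -> s w = s x1 -> u != w -> ~~ e y1 u -> e y1 w) ->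
  e x1 y1 -> e x2 z2 -> z2 != y1 -> hamiltonian e.
Proof.
move=> sx2 sy1 n12 nr full_out full_in y1_out exy1 exz2 nz2.
have sz2 : s z2 = s y1 by rewrite (side _ _ exz2) sx2 sy1.
case: (boolP (e y1 x2)) => [eyx2|nyx2].
  apply: (cycle4_extend x1 y1 x2 z2) => //; [exact: full_out | by rewrite eq_sym |].
  by move=> v; rewrite !inE !negb_or => /and4P[? ? ? _]; apply: nr.
have [x sx] := fresh3 (s x1) [:: x1; x2] isT.
rewrite !inE negb_or => /andP[nx1 nx2].
have [z sz] := fresh3 (s y1) [:: y1; z2] isT.
rewrite !inE negb_or => /andP[nz1 nzz2].
apply: (cycle6_extend x1 y1 x z x2 z2) => //.
- by apply: y1_out nyx2; rewrite // eq_sym.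
- exact: full_in.
- exact: full_out.
- exact: full_out.
- by rewrite /= !inE negb_or [x1 == x]eq_sym nx1 n12 nx2.
- by rewrite /= !inE negb_or ![y1 == _]eq_sym nz1 nz2 nzz2.
by move=> v; rewrite !inE !negb_or => /and5P[? ? _ _ /andP[? _]]; apply: nr.
Qed.

(** No vertex is dominated by both [x1] and [x2], which locates the arc that a rich opposite vertex
    lacks. The degree condition applied with [y0] then makes the opposite side dense enough for a 4-
    or 6-cycle through all exceptions. *)
Lemma two_poor_hamiltonian (x1 x2 y0 : T) : x1 != x2 -> s x2 = s x1 ->
  ~~ rich x1 -> ~~ rich x2 -> s y0 = ~~ s x1 -> rich y0 -> hamiltonian e.
Proof.
move=> n12 sx2 poor1 poor2 sy0 ry0.
have opp x y : s x = s x1 -> s y = s y0 -> s x = ~~ s y.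
  by move=> -> ->; rewrite sy0 negbK.
have miss y : ~~ e x1 y \/ ~~ e x2 y.
  case: (boolP (e x1 y)) => [h|]; last by left.
  by right; apply: poor_disjoint h.
(* The one arc that a rich [y] lacks comes from [x1] or [x2], so all other arcs at [y] are
   present. *)
have full_rich y : s y = s y0 -> rich y -> forall x, s x = s x1 ->
    e y x /\ (x != x1 -> x != x2 -> e x y).
  move=> sy ry x sx.
  have cov (u v : T) : s u = s x1 -> s v = s x1 -> u != v -> ~~ e u y ->
      e y v && e v y.
    move=> su sv nuv nu; apply: (rich_miss1 y u v ry (opp _ _ su sy)) => //.
      exact: opp.
    by rewrite (negbTE nu) andbF.
  have out (u : T) : s u = s x1 -> ~~ e u y -> e y u.
    by move=> su nu; have := rich_adj _ _ ry (opp _ _ su sy); rewrite (negbTE nu) orbF.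
  have key (u : T) : s u = s x1 -> ~~ e u y -> e y x /\ (x != u -> e x y).
    move=> su nu; case: (eqVneq x u) => [->|nxu]; first by split=> //; apply: out.
    by have /andP[] := cov u x su sx (contra_neq esym nxu) nu.
  by case: (miss y) => [/key|/key] [] // h1 h2; split=> // *; apply: h2.
have ltin w : s w = s y0 -> indeg e w < a.
  by move=> sw; case: (miss w) => h; apply: indeg_lt h; apply: opp.
(* [y0] dominates the whole opposite side, so it shares an out-neighbour with every [y]; its degree
   is at most [2 * a - 1], which leaves [2 * a - 2] for [y]. *)
have deg_y y : s y = s y0 -> 2 * a - 2 <= deg e y.
  move=> sy.
  have le0 : deg e y0 < 2 * a.
    by have := ltin y0 erefl; have := outdegC y0; rewrite /deg; clear; lia.
  case: (eqVneq y y0) => [->|nyy0]; first by move: ry0; rewrite /rich; clear; lia.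
  have [x eyx] := out_neighbour y.
  have sx : s x = s x1 by rewrite (side _ _ eyx) sy sy0 negbK.
  have [ey0x _] := full_rich y0 erefl ry0 x sx.
  by move: le0 (degree_sum y y0 nyy0 (ex_intro _ x (conj eyx ey0x))); clear; lia.
have out_y y : s y = s y0 -> forall u w, s u = s x1 -> s w = s x1 -> u != w ->
    ~~ e y u -> e y w.
  move=> sy u w su sw nuw; apply: outdeg_miss1 => //; try exact: opp.
  by have := ltin y sy; have := deg_y y sy; rewrite /deg; clear; lia.
have [x3 sx3] := fresh3 (s x1) [:: x1; x2] isT.
rewrite !inE negb_or => /andP[n31 n32].
(* Two poor vertices here would have disjoint out-neighbourhoods, each lacking at most one vertex
   opposite; three such vertices refute this. If none is poor, [y0] takes the place of [y1]. *)
have [y1 sy1 rich_y] : exists2 y1, s y1 = s y0 &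
    forall v, s v = s y0 -> v != y1 -> rich v.
  case: (pickP [pred v | (s v == s y0) && ~~ rich v]) => [y1|none]; last first.
    exists y0 => // v sv _; apply: contraFT (none v) => nr.
    by rewrite /= sv eqxx.
  case/andP=> /eqP sy1 nr1; exists y1 => // y2 sy2 n21; apply: contraT => nr2.
  have dis x : e y1 x -> ~~ e y2 x.
    by apply: poor_disjoint; rewrite // eq_sym.
  have hit x x' : s x = s x1 -> s x' = s x1 -> x != x' -> e y1 x -> e y1 x' -> False.
    move=> sx sx' nxx' h h'.
    by have := out_y y2 sy2 x x' sx sx' nxx' (dis _ h); rewrite (negbTE (dis _ h')).
  case: (boolP (e y1 x1)) => h1.
    case: (boolP (e y1 x2)) => h2; first by case: (hit x1 x2).
    by case: (hit x1 x3); rewrite // 1?eq_sym //; apply: out_y h2; rewrite // eq_sym.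
  by case: (hit x2 x3); rewrite // 1?eq_sym //; apply: out_y h1; rewrite // eq_sym.
(* The rich [y0] lacks at most one in-arc, yet of three poor vertices at most one could dominate
   it. *)
have rich_x v : s v = s x1 -> v != x1 -> v != x2 -> rich v.
  move=> sv nv1 nv2; apply: contraT => nrv.
  have two u w : s u = s x1 -> s w = s x1 -> u != w -> ~~ rich u -> ~~ rich w ->
      e u y0 /\ ~~ e w y0 \/ e w y0 /\ ~~ e u y0.
    move=> su sw nuw ru rw; case: (boolP (e u y0)) => hu.
      by left; split=> //; apply: poor_disjoint hu.
    right; split=> //.
    have := rich_miss1 y0 u w ry0 (opp _ _ su erefl) (opp _ _ sw erefl) nuw.
    by rewrite (negbTE hu) andbF => /(_ isT)/andP[].
  case: (two x1 x2 erefl sx2 n12 poor1 poor2) => -[h h'].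
    case: (two x2 v sx2 sv _ poor2 nrv); rewrite 1?eq_sym //.
      by rewrite (negbTE h') => -[].
    by move=> [hv _]; have := poor_disjoint _ _ y0 nrv poor1 nv1 hv; rewrite h.
  case: (two x1 v erefl sv _ poor1 nrv); rewrite 1?eq_sym //.
    by rewrite (negbTE h') => -[].
  by move=> [hv _]; have := poor_disjoint _ _ y0 nrv poor2 nv2 hv; rewrite h.
have nr v : v != x1 -> v != x2 -> v != y1 -> rich v.
  move=> nv1 nv2 nvy; case: (eqVneq (s v) (s x1)) => sv; first exact: rich_x.
  by apply: rich_y => //; rewrite sy0; case: (s v) (s x1) sv => [] [].
have full_out y x : s y = s y1 -> y != y1 -> s x = s x1 -> e y x.
  move=> sy ny sx; have sy' : s y = s y0 by rewrite sy.
  by have [] := full_rich y sy' (rich_y y sy' ny) x sx.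
have full_in y x : s y = s y1 -> y != y1 -> s x = s x1 -> x != x1 -> x != x2 ->
    e x y.
  move=> sy ny sx nx1 nx2; have sy' : s y = s y0 by rewrite sy.
  by have [_] := full_rich y sy' (rich_y y sy' ny) x sx; apply.
have y1_out := out_y y1 sy1.
have sy1x : s y1 = ~~ s x1 by rewrite sy1.
have [z1 e1] := out_neighbour x1; have [z2 e2] := out_neighbour x2.
have nz12 : z1 != z2.
  by apply: contraTneq e2 => <-; apply: poor_disjoint e1.
have sz1 : s z1 = s y1 by rewrite (side _ _ e1).
have sz2 : s z2 = s y1 by rewrite (side _ _ e2) sx2.
case: (eqVneq z1 y1) => [E1|nz1].
  rewrite E1 in e1 nz12.
  by apply: (two_poor_y1_hamiltonian x1 x2 y1 z2); rewrite // eq_sym.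
case: (eqVneq z2 y1) => [E2|nz2].
  rewrite E2 in e2 nz12.
  apply: (two_poor_y1_hamiltonian x2 x1 y1 z1); rewrite ?sx2 // 1?eq_sym //.
    by move=> v ? ? ?; apply: nr.
  by move=> y x ? ? ? ? ?; apply: full_in.
(* The in-degree of [y1] is at least [a - 2], hence at least two, and [x1], [x2] do not both
   dominate [y1]. *)
have [x [sx nx1 nx2 exy1]] : exists x, [/\ s x = s x1, x != x1, x != x2 & e x y1].
  case: (pickP [pred x | [&& x != x1, x != x2 & e x y1]]) => [x|none].
    case/and3P=> nx1 nx2 exy1; exists x; split=> //.
    by apply: negb_inj; rewrite -(side _ _ exy1).
  have out_le : outdeg e y1 <= a by have := outdegC y1; clear; lia.
  have in_ge : 1 < indeg e y1.
    by move: out_le a_gt3 (deg_y y1 sy1); rewrite /deg; clear; lia.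
  case/card_gt1P: in_ge => u [w []]; rewrite !inE => eu ew nuw.
  have x12 v : e v y1 -> (v == x1) || (v == x2).
    by move=> ev; apply: contraFT (none v); rewrite negb_or /= ev andbT.
  have ex : e x1 y1 /\ e x2 y1.
    case/orP: (x12 u eu) => /eqP Eu; case/orP: (x12 w ew) => /eqP Ew;
      by move: eu ew nuw; rewrite Eu Ew ?eqxx.
  by case: (miss y1); rewrite ?(proj1 ex) ?(proj2 ex).
(* [y1] dominates [x1] or [x2]; the two cases give 6-cycles with [x1] and [x2] exchanged. *)
case: (boolP (e y1 x2)) => [eyx2|nyx2].
  apply: (cycle6_extend x1 z1 x y1 x2 z2) => //.
  - exact: full_out.
  - exact: full_out.
  - by rewrite /= !inE negb_or [x1 == x]eq_sym nx1 n12 nx2.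
  - by rewrite /= !inE negb_or nz1 nz12 eq_sym nz2.
  by move=> v; rewrite !inE !negb_or => /and5P[? _ _ ? /andP[? _]]; apply: nr.
have eyx1 : e y1 x1 by apply: y1_out nyx2; rewrite // eq_sym.
apply: (cycle6_extend x2 z2 x y1 x1 z1) => //.
- exact: full_out.
- exact: full_out.
- by rewrite /= !inE negb_or [x2 == x]eq_sym nx2 eq_sym n12 nx1.
- by rewrite /= !inE negb_or nz2 [z2 == _]eq_sym nz12 eq_sym nz1.
by move=> v; rewrite !inE !negb_or => /and5P[? _ _ ? /andP[? _]]; apply: nr.
Qed.

Lemma bipartite_hamiltonian : hamiltonian e.
Proof.
(* Two poor vertices on side [b] already give a hamiltonian cycle, whether or not the other side has
   a rich vertex. *)
have exc b : hamiltonian e \/ exists2 x, s x = b &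
    forall v, s v = b -> v != x -> rich v.
  case: (pickP [pred x | (s x == b) && ~~ rich x]) => [x1|none]; last first.
    have [x sx _] := fresh3 b [::] isT; right; exists x => // v sv _.
    by apply: contraFT (none v) => nr; rewrite /= sv eqxx.
  case/andP=> /eqP sx1 poor1.
  case: (pickP [pred x | [&& s x == b, ~~ rich x & x != x1]]) => [x2|none]; last first.
    right; exists x1 => // v sv nv; apply: contraFT (none v) => nr.
    by rewrite /= sv eqxx nv nr.
  case/and3P=> /eqP sx2 poor2 n21; left.
  case: (pickP [pred y | (s y == ~~ b) && rich y]) => [y0|none].
    case/andP=> /eqP sy0 ry0.
    apply: (two_poor_hamiltonian x1 x2 y0); rewrite ?sx1 // 1?eq_sym //.
  apply: (no_rich_side_hamiltonian (~~ b)) => v sv.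
  by apply/negP => rv; have := none v; rewrite /= sv eqxx rv.
case: (exc true) => // -[x1 sx1 nrx]; case: (exc false) => // -[y1 sy1 nry].
apply: (one_exception_hamiltonian x1 y1); first by rewrite sx1 sy1.
move=> v nvx nvy; case E: (s v); first exact: nrx.
exact: nry.
Qed.

End Bipartite.

Theorem theorem1p10 (T : finType) (e : rel T) (a : nat)
  (loopless : irreflexive e)
  (strong : strongly_connected e)
  (balanced : balanced_bipartite e)
  (order_eq : #|T| = 2 * a)
  (order_ge : 2 * a >= 8)
  (degree_sum : forall x y : T, x != y -> common_out_neighbour e x y ->
     deg e x + deg e y >= 4 * a - 3)
  (not_D8 : ~ isomorphic e D8) :
  hamiltonian e.
Proof.
case: balanced => X [Y [[XY dXY arcs] cXY]].
have memY v : (v \in Y) = (v \notin X).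
  have := in_setT v; rewrite -XY inE; case: (boolP (v \in X)) => //= vX _.
  by apply/negP => vY; move/pred0P/(_ v): dXY; rewrite /= vX vY.
have cX : #|X| + #|Y| = 2 * a.
  by rewrite -order_eq -cardsT -XY cardsU disjoint_setI0 // cards0 subn0.
(* Membership in [X] serves as the side function. *)
apply: (@bipartite_hamiltonian T e a (mem X)) => //; last by lia.
- by move=> u v /arcs; rewrite !memY /=; case: (u \in X); case: (v \in X).
move=> [].
  rewrite (_ : [set v | _] = X); first by lia.
  by apply/setP => v; rewrite inE eqb_id.
rewrite (_ : [set v | _] = Y); first by lia.
by apply/setP => v; rewrite inE memY /= eqbF_neg.
Qed.
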